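(* For any fixed integer $k \geq 3$, the numbers $\operatorname{SG}^{(k)}_n$ and $\operatorname{CSG}^{(k)}_n$ of $k$-regular graphs and of connected $k$-regular graphs on $n$ vertices satisfy, as $n\to\infty$, \[ \operatorname{CSG}^{(k)}_n = \operatorname{SG}^{(k)}_n\left(1 + \Theta\big(n^{-(k+1)(k-2)/2}\big)\right). \]
   Context: Graphs are simple (no loops or multiple edges) on the labeled vertex set $\{1,\ldots,n\}$; $k$-regular means every vertex has degree $k$. *)

(* Defs.v *)
From HB Require Import structures.
From mathcomp Require Import all_boot all_order all_algebra.
Set Implicit Arguments. Unset Strict Implicit. Unset Printing Implicit Defensive.

(* A simple graph on the labeled vertex set 'I_n (= {1,...,n} shifted to
   {0,...,n-1}) is given by its neighbourhood function g : 'I_n -> {set 'I_n},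
   required to be symmetric and loopless.  Distinct such functions are
   distinct labeled graphs. *)
Definition graph (n : nat) := {ffun 'I_n -> {set 'I_n}}.

Definition simple_graph n (g : graph n) : bool :=
  [forall x, x \notin g x] && [forall x, forall y, (y \in g x) == (x \in g y)].

Definition regular n (k : nat) (g : graph n) : bool :=
  [forall x, #|g x| == k].

Definition gconnected n (g : graph n) : bool :=
  [forall x, forall y, connect (fun u v => v \in g u) x y].

Definition SG (k n : nat) : nat :=
  #|[set g : graph n | simple_graph g && regular k g]|.

Definition CSG (k n : nat) : nat :=
  #|[set g : graph n | [&& simple_graph g, regular k g & gconnected g]]|.

(* Main.v *)
(* Write S(n) for SG k n.  Replacing edges u-w of a k-regular graph by edges
   u-x, w-y to new vertices x, y gives
     S(n+h) (k!)^h >= S(n) (kn - O(1))^(kh/2),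
   which is sharp up to a factor 1 - O(1/n); over the addition of at most n/2
   vertices to n/2 old ones these factors lose only a constant.  Together with
   the configuration-model bound S(m) (k!)^m <= (km-1)!!, this bounds the number
   C(n,m) S(m) S(n-m) of graphs split into parts of sizes m <= n/2 and n-m by
     O(S(n)) C(n,m) / C(kn/2,km/2) <= O(S(n)) / C((k-2)n/2,(k-2)m/2).
   As m >= k+1, the sum over m is O(S(n) n^-((k+1)(k-2)/2)).
   Conversely, splitting k+1 pairwise distant vertices off a graph as a
   component K_(k+1) shows S(n) = O(n^(k(k+1)/2) S(n-k-1)), so that the graphs
   made of K_(k+1) and one other component already form a fraction of that
   order. *)
Require Import Defs.
From HB Require Import structures.
From mathcomp Require Import all_boot all_order all_algebra.
From mathcomp Require Import zify ring.
Set Implicit Arguments. Unset Strict Implicit. Unset Printing Implicit Defensive.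

(** * Counting tools for finite sets *)

Lemma card_set_pair (S T : finType) (D : {set S}) (F : S -> {set T}) :
  #|[set p : S * T | (p.1 \in D) && (p.2 \in F p.1)]| = \sum_(x in D) #|F x|.
Proof.
rewrite -sum1_card (eq_bigl (fun p => (p.1 \in D) && (p.2 \in F p.1))).
  rewrite -(pair_big_dep (mem D) (fun x y => y \in F x) (fun _ _ => 1)) /=.
  by apply: eq_bigr => x _; rewrite sum1_card.
by move=> p; rewrite inE.
Qed.

Lemma leq_card_inj_in (S T : finType) (f : S -> T) (D : {set S}) (F : {set T}) :
  {in D &, injective f} -> (forall x, x \in D -> f x \in F) -> #|D| <= #|F|.
Proof.
move=> injf fDF; rewrite -(card_in_imset injf); apply: subset_leq_card.
by apply/subsetP => _ /imsetP[x xD ->]; apply: fDF.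
Qed.

Lemma card_bigcup_leq (I T : finType) (P : pred I) (F : I -> {set T}) :
  #|\bigcup_(i | P i) F i| <= \sum_(i | P i) #|F i|.
Proof.
elim/big_rec2: _ => [|i n U _ le]; first by rewrite cards0.
by rewrite (leq_trans (leq_card_setU _ _).1) // leq_add2l.
Qed.

(** Greedy choice: each new entry is prepended, and each of the fewer than [L] entries already
    present rules out at most [d] elements of [D]. *)
Lemma card_nonconflicting (X : finType) (D : {set X}) (c : rel X) (d L : nat) :
  (forall x, x \in D -> #|[set y in D | c y x]| <= d) ->
  (#|D| - d * L) ^ L <=
    #|[set t : L.-tuple X | all (mem D) t && pairwise (fun x y => ~~ c x y) t]|.
Proof.
move=> cd.
(* The length [M] varies while the base keeps the final [L], so that one bound on the number of
   choices serves every step. *)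
suff H M : M <= L -> (#|D| - d * L) ^ M <=
    #|[set t : M.-tuple X | all (mem D) t && pairwise (fun x y => ~~ c x y) t]|.
  exact: H.
elim: M => [_|M IH ltML].
  rewrite expn0 card_gt0; apply/set0Pn; exists [tuple].
  by rewrite inE.
set Y := [set t : M.-tuple X | _] in IH.
pose F (t : M.-tuple X) := [set x in D | all (fun y => ~~ c x y) t].
have FP t : t \in Y -> #|D| - d * L <= #|F t|.
  rewrite inE => /andP[tD _].
  have sub : D :\: F t \subset \bigcup_(i < M) [set x in D | c x (tnth t i)].
    apply/subsetP => x; rewrite !inE => /andP[+ xD]; rewrite xD /= => /allPn[y].
    move=> /tnthP[i ->]; rewrite negbK => cxy; apply/bigcupP; exists i => //.
    by rewrite inE xD.
  have : #|D :\: F t| <= d * L.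
    apply: leq_trans (subset_leq_card sub) _.
    apply: leq_trans (_ : \sum_(i < M) d <= _); last first.
      by rewrite sum_nat_const card_ord mulnC leq_mul2l (ltnW ltML) orbT.
    apply: leq_trans (card_bigcup_leq _ _) _.
    apply: leq_sum => i _; apply: cd.
    by move/allP: tD; apply; apply: mem_tnth.
  have FD : F t \subset D by apply/subsetP => x; rewrite inE => /andP[].
  by rewrite cardsDS //; lia.
have := leq_card_inj_in (f := fun p : M.-tuple X * X => [tuple of p.2 :: p.1])
  (D := [set p : M.-tuple X * X | (p.1 \in Y) && (p.2 \in F p.1)]).
move=> /(_ [set t : M.+1.-tuple X | all (mem D) t && pairwise (fun x y => ~~ c x y) t]).
rewrite card_set_pair => le.
apply: leq_trans (le _ _).
- apply: leq_trans (_ : \sum_(x in Y) (#|D| - d * L) <= _).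
    by rewrite sum_nat_const expnSr leq_mul2r (IH (ltnW ltML)) orbT.
  exact: leq_sum.
- move=> [t x] [t' x'] _ _ /= /(congr1 val) /= [-> tt'].
  by congr pair; apply: val_inj.
move=> [t x]; rewrite !inE /= => /andP[/andP[-> ->] /andP[-> ->]] //.
Qed.

(** * Regular graphs on a subset of a finite type *)

Definition fgraph_on (V : finType) := {ffun V -> {set V}}.

(* A k-regular graph with vertex set A is encoded, without changing the ambient
   type V, by leaving the vertices off A isolated. *)
Definition reg_on (V : finType) (k : nat) (A : {set V}) : {set fgraph_on V} :=
  [set g : fgraph_on V |
    [&& [forall x, x \notin g x], [forall x, forall y, (y \in g x) == (x \in g y)]
      & [forall x, #|g x| == k * (x \in A)]]].

Section RegOn.
Variables (V : finType) (k : nat).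
Implicit Types (A : {set V}) (g : fgraph_on V).

Lemma reg_onP A g :
  reflect [/\ forall x, x \notin g x, forall x y, (y \in g x) = (x \in g y)
            & forall x, #|g x| = k * (x \in A)]
          (g \in reg_on k A).
Proof.
rewrite inE; apply: (iffP and3P) => -[].
  move=> /forallP irr /forallP sym /forallP deg; split=> // [x y|x].
    by have /forallP/(_ y)/eqP := sym x.
  exact/eqP.
move=> irr sym deg; split; apply/forallP => x //; last by rewrite deg.
by apply/forallP => y; rewrite sym.
Qed.

Lemma reg_on_irr A g x : g \in reg_on k A -> x \notin g x.
Proof. by case/reg_onP. Qed.

Lemma reg_on_sym A g x y : g \in reg_on k A -> (y \in g x) = (x \in g y).
Proof. by case/reg_onP. Qed.

Lemma reg_on_deg A g x : g \in reg_on k A -> #|g x| = k * (x \in A).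
Proof. by case/reg_onP. Qed.

Lemma reg_on_degT A g x : g \in reg_on k A -> x \in A -> #|g x| = k.
Proof. by move=> gA xA; rewrite (reg_on_deg _ gA) xA muln1. Qed.

Lemma reg_on_out A g x : g \in reg_on k A -> x \notin A -> g x = set0.
Proof.
move=> gA xA; apply: cards0_eq.
by rewrite (reg_on_deg _ gA) (negbTE xA) muln0.
Qed.

Lemma reg_on_inl A g x y : g \in reg_on k A -> y \in g x -> x \in A.
Proof.
move=> gA; apply: contraTT => xA; by rewrite (reg_on_out gA xA) inE.
Qed.

Lemma reg_on_inr A g x y : g \in reg_on k A -> y \in g x -> y \in A.
Proof. by move=> gA; rewrite (reg_on_sym _ _ gA); apply: reg_on_inl. Qed.

End RegOn.

Lemma SG_reg_on k n : SG k n = #|reg_on k [set: 'I_n]|.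
Proof.
apply: eq_card => g; rewrite !inE /simple_graph /regular -andbA.
by do 2!congr (_ && _); apply: eq_forallb => x; rewrite inE muln1.
Qed.

(** * Transport of regular graphs along an injection *)

Section Push.
Variables (W V : finType) (f : W -> V).
Hypothesis injf : injective f.

Definition push_graph (g : fgraph_on W) : fgraph_on V :=
  [ffun x => [set y | [exists i, [exists j, [&& x == f i, y == f j & j \in g i]]]]].

Definition pull_graph (g : fgraph_on V) : fgraph_on W :=
  [ffun i => [set j | f j \in g (f i)]].

Lemma in_push_graph g i j : (f j \in push_graph g (f i)) = (j \in g i).
Proof.
rewrite ffunE inE; apply/existsP/idP => [[i' /existsP[j']]|ji].
  by case/and3P => /eqP/injf-> /eqP/injf->.
by exists i; apply/existsP; exists j; rewrite !eqxx.
Qed.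

Lemma push_graphP g x y : y \in push_graph g x ->
  exists i j, [/\ x = f i, y = f j & j \in g i].
Proof.
rewrite ffunE inE => /existsP[i /existsP[j /and3P[/eqP-> /eqP-> ji]]].
by exists i, j.
Qed.

Lemma push_graphE g i : push_graph g (f i) = f @: g i.
Proof.
apply/setP => y; apply/idP/imsetP => [|[j ji ->]]; last by rewrite in_push_graph.
by case/push_graphP => i' [j [/injf-> -> ji]]; exists j.
Qed.

Lemma push_graphK : cancel push_graph pull_graph.
Proof.
move=> g; apply/ffunP => i; apply/setP => j.
by rewrite ffunE inE in_push_graph.
Qed.

Lemma push_graph_reg k (A : {set W}) g :
  g \in reg_on k A -> push_graph g \in reg_on k (f @: A).
Proof.
move=> gA; apply/reg_onP; split=> [x|x y|x].
- apply/negP => /[dup] /push_graphP [i [j [-> _ _]]].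
  by rewrite in_push_graph (negbTE (reg_on_irr _ gA)).
- apply/idP/idP => /push_graphP [i [j [-> ->]]];
    by rewrite in_push_graph (reg_on_sym _ _ gA).
have [/existsP[i /eqP->]|] := boolP [exists i, x == f i].
  by rewrite push_graphE card_imset // (reg_on_deg _ gA) mem_imset.
rewrite negb_exists => /forallP xf.
have -> : (x \in f @: A) = false.
  by apply/imsetP => -[i _ /eqP]; rewrite (negbTE (xf i)).
rewrite muln0; apply: eq_card0 => y; apply/negP => /push_graphP[i [j [/eqP]]].
by rewrite (negbTE (xf i)).
Qed.

Lemma card_reg_on_imset k (A : {set W}) : #|reg_on k (f @: A)| = #|reg_on k A|.
Proof.
rewrite -(card_imset _ (can_inj push_graphK)); apply: eq_card => G.
apply/idP/imsetP => [GA|[g gA ->]]; last exact: push_graph_reg.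
have GK : G = push_graph (pull_graph G).
  apply/ffunP => x; apply/setP => y; apply/idP/idP.
    move=> yx; have /imsetP[i _ xi] := reg_on_inl GA yx.
    have /imsetP[j _ yj] := reg_on_inr GA yx.
    by rewrite xi yj in_push_graph ffunE inE -xi -yj.
  by case/push_graphP => i [j [-> ->]]; rewrite ffunE inE.
exists (pull_graph G) => //; apply/reg_onP; split=> [i|i j|i].
- by rewrite ffunE inE (reg_on_irr _ GA).
- by rewrite !ffunE !inE (reg_on_sym _ _ GA).
rewrite -(card_imset _ injf) -push_graphE -GK (reg_on_deg _ GA).
by rewrite mem_imset.
Qed.

End Push.

(** The enumeration of [A] is an injection from an ordinal type with image [A]. *)
Lemma card_reg_on (V : finType) k (A : {set V}) : #|reg_on k A| = SG k #|A|.
Proof.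
rewrite SG_reg_on -(card_reg_on_imset (f := @enum_val V (mem A))).
  congr #|reg_on k _|; apply/setP => x; apply/idP/imsetP => [xA|[i _ ->]].
    by exists (enum_rank_in xA x); rewrite ?inE // enum_rankK_in.
  exact: enum_valP.
exact: enum_val_inj.
Qed.

(** * The edge exchange that adds or removes a set of vertices *)

Section Toggle.
Variables (V T : finType) (o : T * bool -> V).
Implicit Types (g : fgraph_on V) (p : {ffun T * bool -> V}).

(** A slot [(t, b)] is one end of the edge indexed by [t]; the map passes to the other end of that
    edge. *)
Definition opp_slot (s : T * bool) := (s.1, ~~ s.2).

Lemma opp_slotK : involutive opp_slot.
Proof. by case=> t b; rewrite /opp_slot /= negbK. Qed.

Lemma opp_slot_neq s : opp_slot s != s.
Proof. by case: s => t [] ; rewrite /opp_slot /= xpair_eqE andbF. Qed.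

Definition toggled p (x y : V) : bool :=
  [exists s, [|| (x == p s) && (y == p (opp_slot s)), (x == p s) && (y == o s)
               | (x == o s) && (y == p s)]].

(* With p s in A and o s a new vertex, this exchanges the edges p s -- p (opp_slot s)
   and p s -- o s.  The symmetric difference makes both directions of the
   exchange the same involution. *)
Definition toggle p g : fgraph_on V :=
  [ffun x => [set y | (y \in g x) (+) toggled p x y]].

Lemma toggleK p : involutive (toggle p).
Proof.
move=> g; apply/ffunP => x; apply/setP => y.
by rewrite !(ffunE, inE) -addbA addbb addbF.
Qed.

Lemma toggled_sym p x y : toggled p x y = toggled p y x.
Proof.
have imp u v : toggled p u v -> toggled p v u.
  case/existsP => s /or3P[] /andP[/eqP-> /eqP->]; apply/existsP.
  - by exists (opp_slot s); rewrite opp_slotK !eqxx.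
  - by exists s; rewrite !eqxx !orbT.
  - by exists s; rewrite !eqxx !orbT.
by apply/idP/idP; apply: imp.
Qed.

Variables (A B : {set V}) (p : {ffun T * bool -> V}) (k : nat).
Hypothesis AB : [disjoint A & B].
Hypothesis oB : forall s, o s \in B.
Hypothesis oF : forall b, b \in B -> #|[set s | o s == b]| = k.
Hypothesis injp : injective p.
Hypothesis pA : forall s, p s \in A.

Let poF s s' : (p s == o s') = false.
Proof.
by apply/eqP => e; have := pA s; rewrite e (disjointFl AB).
Qed.

(** Injectivity of [p] singles out the slot [s], and [p] never meets [o] because [A] and [B] are
    disjoint. *)
Lemma toggledP s y : toggled p (p s) y = (y == p (opp_slot s)) || (y == o s).
Proof.
apply/existsP/idP => [[s'] /or3P[] /andP[]|].
- by move=> /eqP/injp-> ->.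
- by move=> /eqP/injp-> ->; rewrite orbT.
- by rewrite poF.
by case/orP => /eqP->; exists s; rewrite !eqxx ?orbT.
Qed.

Lemma toggled_new b y : b \in B ->
  toggled p b y = (y \in p @: [set s | o s == b]).
Proof.
move=> bB; apply/existsP/imsetP => [[s]|[s]].
  have bp s' : (b == p s') = false.
    by apply/eqP => e; have := pA s'; rewrite -e (disjointFl AB).
  rewrite !bp /= => /andP[/eqP-> /eqP->]; exists s => //.
  by rewrite inE.
by rewrite inE => /eqP<- ->; exists s; rewrite !eqxx !orbT.
Qed.

Lemma toggled_out x y : x \notin B -> x \notin codom p -> toggled p x y = false.
Proof.
move=> xB xp; apply/existsP => -[s].
have -> : (x == p s) = false by apply/eqP => e; rewrite e codom_f in xp.
have -> // : (x == o s) = false by apply/eqP => e; rewrite e oB in xB.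
Qed.

Lemma toggled_irr x : toggled p x x = false.
Proof.
apply/existsP => -[s /or3P[] /andP[/eqP->]].
- by rewrite (inj_eq injp) eq_sym (negbTE (opp_slot_neq s)).
- by rewrite poF.
- by rewrite eq_sym poF.
Qed.

(** Exactly one of the two edges exchanged at [p s] is present, so the exchange replaces one
    neighbour by another. *)
Lemma toggle_deg_slot g s :
  (p (opp_slot s) \in g (p s)) (+) (o s \in g (p s)) ->
  #|toggle p g (p s)| = #|g (p s)|.
Proof.
move=> add.
have [u [v [uv ug vg E]]] : exists u v, [/\ u != v, u \in g (p s), v \notin g (p s)
   & forall y, toggled p (p s) y = (y == u) || (y == v)].
  case E : (p (opp_slot s) \in g (p s)) add => /= add.
    by exists (p (opp_slot s)), (o s); rewrite poF; split=> // y; rewrite toggledP.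
  exists (o s), (p (opp_slot s)); rewrite eq_sym poF E; split=> // y.
  by rewrite toggledP orbC.
have -> : toggle p g (p s) = v |: (g (p s) :\ u).
  apply/setP => y; rewrite ffunE !inE E.
  have [->|yu] := eqVneq y u; first by rewrite ug (negbTE uv).
  have [->|yv] := eqVneq y v; first by rewrite (negbTE vg).
  by rewrite addbF.
by rewrite cardsU1 !inE (negbTE vg) andbF [RHS](cardsD1 u) ug.
Qed.

(** A new vertex [b] is joined to the [k] distinct vertices [p s] whose slots have [o s] equal to
    [b], while old degrees do not change. *)
Lemma toggle_up g : g \in reg_on k A -> (forall s, p (opp_slot s) \in g (p s)) ->
  toggle p g \in reg_on k (A :|: B).
Proof.
move=> gA pg; apply/reg_onP; split=> [x|x y|x].
- by rewrite ffunE inE toggled_irr addbF (reg_on_irr _ gA).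
- by rewrite !ffunE !inE toggled_sym (reg_on_sym _ _ gA).
have [xB|xB] := boolP (x \in B).
  have gx : g x = set0 by rewrite (reg_on_out gA) // (disjointFl AB).
  rewrite inE xB orbT muln1 -(oF xB) -(card_imset _ injp).
  apply: eq_card => y; rewrite ffunE inE gx inE /=; exact: toggled_new.
rewrite inE (negbTE xB) orbF -(reg_on_deg x gA).
have [/codomP[s ->]|xp] := boolP (x \in codom p).
  rewrite toggle_deg_slot // pg /=; apply/negP => /(reg_on_inr gA).
  by rewrite (disjointFl AB).
by apply: eq_card => y; rewrite ffunE inE toggled_out // addbF.
Qed.

Lemma toggle_up_label g s : g \in reg_on k A -> p s \in toggle p g (o s).
Proof.
move=> gA; rewrite ffunE inE (reg_on_out gA) ?(disjointFl AB) // inE /=.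
by apply/existsP; exists s; rewrite !eqxx !orbT.
Qed.

Lemma toggle_down g : g \in reg_on k (A :|: B) ->
    (forall s, p s \in g (o s)) -> (forall s, p (opp_slot s) \notin g (p s)) ->
  toggle p g \in reg_on k A.
Proof.
move=> gAB pg pn; apply/reg_onP; split=> [x|x y|x].
- by rewrite ffunE inE toggled_irr addbF (reg_on_irr _ gAB).
- by rewrite !ffunE !inE toggled_sym (reg_on_sym _ _ gAB).
have [xB|xB] := boolP (x \in B).
  rewrite (disjointFl AB) // muln0; apply: eq_card0 => y.
  rewrite ffunE inE toggled_new //.
  (* The [k] slots of [x] already account for its whole neighbourhood, so the exchange isolates
     [x]. *)
  suff -> : g x = p @: [set s | o s == x] by rewrite addbb.
  apply/esym/eqP; rewrite eqEcard card_imset // oF // (reg_on_degT gAB) ?inE ?xB ?orbT //.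
  rewrite leqnn andbT; apply/subsetP => _ /imsetP[s + ->].
  by rewrite inE => /eqP<-.
have -> : (x \in A) = (x \in A :|: B) by rewrite inE (negbTE xB) orbF.
rewrite -(reg_on_deg x gAB).
have [/codomP[s ->]|xp] := boolP (x \in codom p).
  by rewrite toggle_deg_slot // (negbTE (pn s)) (reg_on_sym _ _ gAB) pg.
by apply: eq_card => y; rewrite ffunE inE toggled_out // addbF.
Qed.

Lemma toggle_down_edge g s : p (opp_slot s) \notin g (p s) ->
  p (opp_slot s) \in toggle p g (p s).
Proof. by move=> pn; rewrite ffunE inE (negbTE pn) toggledP eqxx. Qed.

End Toggle.

(** * Adding vertices *)

Definition arcs (V : finType) (g : fgraph_on V) := [set e : V * V | e.2 \in g e.1].

Lemma card_arcs (V : finType) k (A : {set V}) g :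
  g \in reg_on k A -> #|arcs g| = k * #|A|.
Proof.
move=> gA; have := card_set_pair [set: V] g.
rewrite (_ : [set p | _] = arcs g); last by apply/setP => e; rewrite !inE.
move=> ->; rewrite (eq_bigr (fun x => k * (x \in A))) => [|x _].
  by rewrite -big_distrr -sum1_card [in RHS]big_mkcond /= (eq_bigl xpredT) // => x; rewrite inE.
exact: reg_on_deg gA.
Qed.

Definition arcs_meet (V : finType) (e f : V * V) :=
  [|| e.1 == f.1, e.1 == f.2, e.2 == f.1 | e.2 == f.2].

(** Each of the four ways to share an endpoint prescribes the source or the target of [e], which
    leaves at most [k] arcs. *)
Lemma card_arcs_meet (V : finType) k (A : {set V}) g f : g \in reg_on k A ->
  #|[set e in arcs g | arcs_meet e f]| <= 4 * k.
Proof.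
move=> gA.
have le1 v : #|[set e in arcs g | e.1 == v]| <= k.
  apply: leq_trans (_ : #|g v| <= k); last first.
    by rewrite (reg_on_deg _ gA); case: (v \in A); rewrite ?muln1 ?muln0.
  apply: (leq_card_inj_in (f := snd)) => [[a b] [c d]|[a b]]; rewrite !inE /=.
    by move=> /andP[_ /eqP->] /andP[_ /eqP->] ->.
  by case/andP => ba /eqP <-.
have le2 v : #|[set e in arcs g | e.2 == v]| <= k.
  apply: leq_trans (le1 v); apply: (leq_card_inj_in (f := fun e => (e.2, e.1))).
    by move=> [a b] [c d] _ _ [-> ->].
  by move=> [a b]; rewrite !inE /= (reg_on_sym _ _ gA).
have -> : [set e in arcs g | arcs_meet e f] =
  ([set e in arcs g | e.1 == f.1] :|: [set e in arcs g | e.1 == f.2]) :|: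
  ([set e in arcs g | e.2 == f.1] :|: [set e in arcs g | e.2 == f.2]).
  by apply/setP => e; rewrite !inE /arcs_meet -!andb_orr !orbA.
apply: leq_trans (leq_card_setU _ _).1 _.
have h1 := leq_trans (leq_card_setU _ _).1 (leq_add (le1 f.1) (le1 f.2)).
have h2 := leq_trans (leq_card_setU _ _).1 (leq_add (le2 f.1) (le2 f.2)).
by have := leq_add h1 h2; lia.
Qed.

Section AddVertices.
Variables (V : finType) (k l : nat) (A B : {set V}) (o : 'I_l * bool -> V).
Hypothesis AB : [disjoint A & B].
Hypothesis oB : forall s, o s \in B.
Hypothesis oF : forall b, b \in B -> #|[set s | o s == b]| = k.

(** These are the data that allow an addition of vertices to be undone: which neighbour of a new
    vertex occupies which slot. *)
Definition labelings (g : fgraph_on V) : {set {ffun 'I_l * bool -> V}} :=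
  [set p : {ffun 'I_l * bool -> V} | injectiveb p && [forall s, p s \in g (o s)]].

Definition tuple_labeling (t : l.-tuple (V * V)) : {ffun 'I_l * bool -> V} :=
  [ffun s => if s.2 then (tnth t s.1).1 else (tnth t s.1).2].

Definition matchings (g : fgraph_on V) : {set l.-tuple (V * V)} :=
  [set t : l.-tuple (V * V) |
     all (mem (arcs g)) t && pairwise (fun e f => ~~ arcs_meet e f) t].

Lemma matching_labeling g t : g \in reg_on k A -> t \in matchings g ->
  [/\ injective (tuple_labeling t), forall s, tuple_labeling t s \in A
    & forall s, tuple_labeling t (opp_slot s) \in g (tuple_labeling t s)].
Proof.
move=> gA; rewrite inE => /andP[/allP tg tm].
have tE i : (tnth t i).2 \in g (tnth t i).1.
  by have := tg _ (mem_tnth i t); rewrite /= inE.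
have tE' i : (tnth t i).1 \in g (tnth t i).2 by rewrite (reg_on_sym _ _ gA).
split=> [|[i b]|[i b]].
- have lt (i j : 'I_l) : i < j -> ~~ arcs_meet (tnth t i) (tnth t j).
    move=> ij; have x0 := tnth t i.
    move/(pairwiseP x0)/(_ i j): tm; rewrite !inE size_tuple !ltn_ord !(tnth_nth x0).
    exact.
  have neq (i j : 'I_l) : i != j -> ~~ arcs_meet (tnth t i) (tnth t j).
    rewrite -val_eqE neq_ltn => /orP[/lt//|/lt].
    rewrite /arcs_meet !negb_or => /and4P[*].
    by apply/and4P; split; rewrite eq_sym.
  move=> [i b] [j c]; rewrite !ffunE /= => e.
  have [ij|/neq] := eqVneq i j.
    rewrite -{}ij in e *; congr pair.
    by case: b c e => [] [] // e; have := tE i; rewrite e (negbTE (reg_on_irr _ gA)).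
  rewrite /arcs_meet !negb_or => /and4P[].
  by case: b c e => [] [] ->; rewrite eqxx.
- by rewrite ffunE; case: b; [apply: reg_on_inr gA (tE' i)|apply: reg_on_inr gA (tE i)].
by rewrite !ffunE; case: b; [apply: tE|apply: tE'].
Qed.

(** Double counting. A graph on [A] with an ordered matching of [l] arcs is sent to the enlarged
    graph with its labeling. The greedy bound counts the matchings below, and [Q] bounds the
    labelings above. *)
Lemma card_add_vertices Q :
  (forall g, g \in reg_on k (A :|: B) -> #|labelings g| <= Q) ->
  #|reg_on k A| * (k * #|A| - 4 * k * l) ^ l <= #|reg_on k (A :|: B)| * Q.
Proof.
move=> lQ; apply: leq_trans (_ : \sum_(g in reg_on k A) #|matchings g| <= _).
  rewrite -sum_nat_const; apply: leq_sum => g gA.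
  rewrite -(card_arcs gA); apply: card_nonconflicting => e _.
  exact: card_arcs_meet gA.
apply: leq_trans (_ : \sum_(g in reg_on k (A :|: B)) #|labelings g| <= _); last first.
  by rewrite -sum_nat_const; apply: leq_sum => g /lQ.
rewrite -!card_set_pair.
(* The labeling determines the matching, and for a fixed labeling the exchange is an involution,
   hence this map is injective. *)
apply: (leq_card_inj_in (f := fun q => (toggle o (tuple_labeling q.2) q.1, tuple_labeling q.2))).
  move=> [g t] [g' t'] _ _ /= [eg ep].
  have tt : t = t'.
    apply: eq_from_tnth => i.
    have := congr1 (fun p : {ffun _} => p (i, true)) ep.
    have := congr1 (fun p : {ffun _} => p (i, false)) ep.
    by rewrite !ffunE /=; case: (tnth t i) (tnth t' i) => [a b] [c d] /= -> ->.
  by move: eg; rewrite tt => /(can_inj (@toggleK _ _ _ _))->.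
move=> [g t]; rewrite [in X in X -> _]inE => /andP[/= gA tm].
have [injp pA pg] := matching_labeling gA tm.
rewrite inE /= (toggle_up AB oB oF injp pA gA pg) inE.
rewrite (introT (injectiveP _) injp) /=.
by apply/forallP => s; apply: (toggle_up_label _ AB oB _ gA).
Qed.

End AddVertices.

(** For even degree one new vertex takes both ends of each of [l] edges. A labeling is then an
    ordering of its [k] neighbours. *)
Lemma SG_add1 k l n : k = l.*2 ->
  SG k n * (k * n - 4 * k * l) ^ l <= SG k n.+1 * k`!.
Proof.
move=> kE; pose b : 'I_n.+1 := ord0; pose A := ~: [set b].
have cA : #|A| = n by rewrite cardsC1 card_ord.
have AB : A :|: [set b] = setT by rewrite setUC setUCr.
rewrite -{1 2}cA -(card_reg_on k A) SG_reg_on -AB.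
apply: (card_add_vertices (o := fun=> b)).
- by rewrite -setI_eq0 setIC /A setICr.
- by move=> _; rewrite inE.
- move=> b'; rewrite inE => /eqP->.
  rewrite (_ : [set s | _] = setT); last by apply/setP => s; rewrite !inE eqxx.
  by rewrite cardsT card_prod card_bool card_ord muln2 kE.
move=> g; rewrite AB => gT.
have gb : #|g b| = k by rewrite (reg_on_degT gT) // inE.
rewrite -ffactnn -{1}gb.
have -> : k = #|{: 'I_l * bool}| by rewrite card_prod card_bool card_ord muln2 kE.
rewrite -card_inj_ffuns_on; apply: subset_leq_card; apply/subsetP => p.
rewrite !inE => /andP[-> /forallP pg]; rewrite andbT.
by apply/ffun_onP => s; apply: pg.
Qed.

(** For any parity, two new vertices each take one end of each of [k] edges. A labeling orders both
    neighbourhoods, whence the square of the factorial. *)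
Lemma SG_add2 k n :
  SG k n * (k * n - 4 * k * k) ^ k <= SG k n.+2 * (k`! ^ 2).
Proof.
pose x : 'I_n.+2 := ord0; pose y : 'I_n.+2 := ord_max.
pose B := [set x; y]; pose A := ~: B.
have cA : #|A| = n.
  by have := cardsC B; rewrite cards2 card_ord -/A => -[].
have AB : A :|: B = setT by rewrite setUC setUCr.
rewrite -{1 2}cA -(card_reg_on k A) SG_reg_on -AB.
apply: (card_add_vertices (o := fun s => if s.2 then x else y)).
- by rewrite -setI_eq0 setIC /A setICr.
- by move=> [t []]; rewrite !inE eqxx ?orbT.
- have key c : #|[set s : 'I_k * bool | (if s.2 then x else y) == (if c then x else y)]| = k.
    rewrite (_ : [set s | _] = setX setT [set c]).
      by rewrite cardsX cardsT cards1 card_ord muln1.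
    apply/setP => -[t b]; rewrite !inE /=.
    by case: b c => [] []; rewrite ?eqxx // -val_eqE.
  by move=> b; rewrite !inE => /orP[]/eqP->; [apply: (key true)|apply: (key false)].
move=> g; rewrite AB => gT.
have gb b : #|[set f : {ffun 'I_k -> 'I_n.+2} in ffun_on (mem (g b)) | injectiveb f]| = k`!.
  by rewrite card_inj_ffuns_on (reg_on_degT gT) ?inE // card_ord ffactnn.
rewrite -mulnn -{1}(gb x) -{1}(gb y) -cardsX.
apply: (leq_card_inj_in (f := fun p : {ffun 'I_k * bool -> 'I_n.+2} =>
  ([ffun t => p (t, true)] : {ffun 'I_k -> 'I_n.+2}, [ffun t => p (t, false)]))).
  move=> p q _ _ [/ffunP e1 /ffunP e2]; apply/ffunP => -[t []].
    by have := e1 t; rewrite !ffunE.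
  by have := e2 t; rewrite !ffunE.
move=> p; rewrite inE => /andP[/injectiveP injp /forallP pg].
rewrite in_setX !inE /=; apply/andP; split; apply/andP; split.
- by apply/ffun_onP => t; rewrite ffunE; apply: (pg (t, true)).
- by apply/injectiveP => t t'; rewrite !ffunE => /injp[].
- by apply/ffun_onP => t; rewrite ffunE; apply: (pg (t, false)).
- by apply/injectiveP => t t'; rewrite !ffunE => /injp[].
Qed.

(** * The configuration-model upper bound *)

(** This is the double factorial of [n - 1] for even [n], the number of perfect matchings of [n]
    points, and zero for odd [n]. *)
Fixpoint pairing_number (n : nat) : nat :=
  match n with 0 => 1 | 1 => 0 | m.+2 => m.+1 * pairing_number m end.

(** A perfect matching of [Q] is encoded as an involution of the ambient type whose fixed points are
    exactly those off [Q], so that points can be removed without a change of type. *)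
Definition pairings (P : finType) (Q : {set P}) : {set {ffun P -> P}} :=
  [set s : {ffun P -> P} |
    [forall x, s (s x) == x] && [forall x, (s x == x) == (x \notin Q)]].

Lemma pairingsP (P : finType) (Q : {set P}) (s : {ffun P -> P}) :
  reflect (involutive s /\ forall x, (s x == x) = (x \notin Q)) (s \in pairings Q).
Proof.
rewrite inE; apply: (iffP andP) => -[inv fixs]; split.
- by move=> x; move/forallP/(_ x)/eqP: inv.
- by move=> x; move/forallP/(_ x)/eqP: fixs.
- by apply/forallP => x; rewrite inv.
- by apply/forallP => x; rewrite fixs.
Qed.

Lemma card_pairings (P : finType) (Q : {set P}) :
  #|pairings Q| <= pairing_number #|Q|.
Proof.
have [n] := ubnP #|Q|; elim: n Q => // n IH Q ltQ.
have [->|[p pQ]] := set_0Vmem Q.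
  rewrite cards0 -[pairing_number 0](cards1 (finfun id : {ffun P -> P})).
  apply: subset_leq_card; apply/subsetP => s /pairingsP[_ fixs].
  rewrite inE; apply/eqP/ffunP => x; rewrite ffunE.
  by apply/eqP; rewrite fixs inE.
apply: leq_trans (_ : \sum_(q in Q :\ p) #|pairings (Q :\ p :\ q)| <= _).
  rewrite -card_set_pair.
  (* Record the partner of [p], then make [p] and its partner fixed points. *)
  pose f (s : {ffun P -> P}) := (s p,
    finfun (fun x => if (x == p) || (x == s p) then x else s x)).
  apply: (leq_card_inj_in (f := f)).
    move=> s t /pairingsP[si _] /pairingsP[ti _] [ep /ffunP es].
    apply/ffunP => x; have := es x; rewrite !ffunE -ep.
    have [->//|xp] := eqVneq x p.
    by have [->|//] := eqVneq x (s p); rewrite /= si ep ti.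
  move=> s /pairingsP[si sf]; rewrite inE /=.
  have spp : s p != p by rewrite sf pQ.
  have spQ : s p \in Q by rewrite -[_ \in _]negbK -sf si eq_sym.
  rewrite !inE spp spQ /=; apply/andP; split; apply/forallP => x; rewrite !ffunE.
    have [->|xp] := eqVneq x p; first by rewrite !eqxx.
    have [->|xq] /= := eqVneq x (s p); first by rewrite eqxx orbT.
    rewrite (inv_eq si) (negbTE xq) (inj_eq (inv_inj si)) (negbTE xp) /=.
    by rewrite si.
  have [->|xp] /= := eqVneq x p; first by rewrite !inE !eqxx andbF.
  have [->|xq] /= := eqVneq x (s p); first by rewrite !inE !eqxx.
  by rewrite sf !inE xp xq.
have cQ := cardsD1 p Q; rewrite pQ /= in cQ.
apply: leq_trans (_ : \sum_(q in Q :\ p) pairing_number #|Q|.-2 <= _).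
  apply: leq_sum => q qQ.
  have cq := cardsD1 q (Q :\ p); rewrite qQ /= in cq.
  have -> : #|Q|.-2 = #|Q :\ p :\ q| by lia.
  by apply: IH; lia.
rewrite sum_nat_const cQ add1n.
by case: #|Q :\ p|.
Qed.

Section PairingBound.
Variables (m k : nat).
Let P := ('I_m * 'I_k)%type.

(** For a [k]-regular graph these are the ways to number, at every vertex, the [k] incident edges by
    their other ends. *)
Definition half_edges (g : fgraph_on 'I_m) : {set {ffun 'I_m -> {ffun 'I_k -> 'I_m}}} :=
  [set f in family (fun x => [pred h : {ffun 'I_k -> 'I_m} |
     (h \in ffun_on (mem (g x))) && injectiveb h])].

Lemma card_half_edges g : g \in reg_on k setT -> #|half_edges g| = k`! ^ m.
Proof.
move=> gT; rewrite cardsE card_family foldrE big_map big_enum /=.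
rewrite (eq_bigr (fun=> k`!)) => [|x _].
  by rewrite prod_nat_const card_ord.
have := card_inj_ffuns_on 'I_k (mem (g x)).
by rewrite cardsE (reg_on_degT gT) ?inE // card_ord ffactnn.
Qed.

(** The point [(x, i)] is matched with the half of the same edge at its other end. The default [s.2]
    is never reached when [f] numbers the edges of a regular graph, by symmetry of adjacency. *)
Definition pairing_of (f : {ffun 'I_m -> {ffun 'I_k -> 'I_m}}) : {ffun P -> P} :=
  [ffun s : P => let y := f s.1 s.2 in
    (y, odflt s.2 [pick j | f y j == s.1])].

Lemma half_edgesP g f : g \in reg_on k setT -> f \in half_edges g ->
  [/\ forall x, injective (f x) & forall x y, (y \in g x) = (y \in codom (f x))].
Proof.
move=> gT; rewrite inE => /familyP fF.
have inj x : injective (f x).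
  by have := fF x; rewrite inE => /andP[_ /injectiveP].
have sub x i : f x i \in g x.
  by have := fF x; rewrite inE => /andP[/ffun_onP/(_ i)].
split=> // x y; apply/idP/codomP => [yx|[i ->//]].
have : y \in f x @: setT.
  suff -> : f x @: setT = g x by [].
  apply/eqP; rewrite eqEcard card_imset // cardsT card_ord (reg_on_degT gT) ?inE //.
  by rewrite leqnn andbT; apply/subsetP => _ /imsetP[i _ ->].
by case/imsetP => i _ ->; exists i.
Qed.

Lemma pairing_ofE g f x i : g \in reg_on k setT -> f \in half_edges g ->
  let t := pairing_of f (x, i) in t.1 = f x i /\ f t.1 t.2 = x.
Proof.
move=> gT fg; have [inj fE] := half_edgesP gT fg.
rewrite /= ffunE /=; split=> //.
have : x \in g (f x i) by rewrite (reg_on_sym _ _ gT) fE codom_f.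
rewrite fE => /codomP[j xj].
case: pickP => [j' /eqP//|/(_ j)].
by rewrite -xj eqxx.
Qed.

Lemma pairing_of_pairings g f : g \in reg_on k setT -> f \in half_edges g ->
  pairing_of f \in pairings setT.
Proof.
move=> gT fg; have [inj fE] := half_edgesP gT fg.
apply/pairingsP; split=> [|[x i]]; last first.
  rewrite inE; apply/eqP => e; have [] := pairing_ofE x i gT fg.
  rewrite e /= => xi; have := reg_on_irr x gT.
  by rewrite fE {1}xi codom_f.
move=> [x i]; have [e1 e2] := pairing_ofE x i gT fg.
case E : (pairing_of f (x, i)) e1 e2 => [y j] /= e1 e2.
have [] := pairing_ofE y j gT fg.
case: (pairing_of f (y, j)) => [z h] /= -> e3; rewrite e2 in e3 *.
by congr pair; apply: (inj x); rewrite e3 e1.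
Qed.

(** The pairing determines the numbering through its first components, and the numbering determines
    the graph, so numbered graphs inject into the perfect matchings of [k * m] points. *)
Lemma SG_le_pairing_number : SG k m * k`! ^ m <= pairing_number (k * m).
Proof.
rewrite SG_reg_on.
apply: leq_trans (_ : \sum_(g in reg_on k [set: 'I_m]) #|half_edges g| <= _).
  by rewrite -sum_nat_const leq_sum // => g gT; rewrite card_half_edges.
rewrite -card_set_pair.
have -> : k * m = #|[set: P]| by rewrite cardsT card_prod !card_ord mulnC.
apply: leq_trans (card_pairings _).
apply: (leq_card_inj_in (f := fun q => pairing_of q.2)); last first.
  by move=> [g f]; rewrite inE => /andP[/= gT fg]; apply: pairing_of_pairings fg.
move=> [g f] [g' f'] + + /= e; rewrite inE => /andP[/= gT fg].
rewrite inE => /andP[/= gT' fg'].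
have ff : f = f'.
  apply/ffunP => x; apply/ffunP => i.
  have [<- _] := pairing_ofE x i gT fg; have [<- _] := pairing_ofE x i gT' fg'.
  by rewrite e.
congr pair => //; apply/ffunP => x; apply/setP => y.
have [_ ->] := half_edgesP gT fg; have [_ ->] := half_edgesP gT' fg'.
by rewrite ff.
Qed.

End PairingBound.

(** * Splitting off a complete component *)

Section CompleteSlots.
Variable h : nat.

(** The slots index the edges of the complete graph on [h] vertices, and [owner] below gives the two
    ends of each edge. *)
Definition slot := {q : 'I_h * 'I_h | q.1 < q.2}.

Definition owner (s : slot * bool) : 'I_h :=
  if s.2 then (val s.1).1 else (val s.1).2.

Lemma owner_opp_neq s : owner (opp_slot s) != owner s.
Proof.
case: s => [[[i j] /= ij] b]; rewrite /owner /=.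
by case: b => /=; rewrite -val_eqE /=; lia.
Qed.

(** Passing to the opposite end identifies the slots owned by [i] with the vertices other than
    [i]. *)
Lemma card_owner i : #|[set s | owner s == i]| = h.-1.
Proof.
have := cardsC1 i; rewrite card_ord => <-.
rewrite -(card_in_imset (f := owner \o @opp_slot slot)).
  apply: eq_card => j; rewrite !inE; apply/imsetP/idP => [[s]|ji].
    by rewrite inE => /eqP<- ->; apply: owner_opp_neq.
  have [ij|ij] := ltnP i j.
    by exists (exist _ (i, j) ij, true); rewrite ?inE /owner.
  have {}ij : j < i by move: ji; rewrite -val_eqE /=; lia.
  by exists (exist _ (j, i) ij, false); rewrite ?inE /owner.
move=> [[[a b] /= ab] c] [[[a' b'] /= ab'] c']; rewrite !inE /owner /=.
case: c c' => [] [] /= /eqP e1 /eqP e2 e; subst; try lia;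
  by congr pair; apply: val_inj.
Qed.

Lemma card_slot : #|{: slot}|.*2 = h * h.-1.
Proof.
have -> : #|{: slot}|.*2 = #|{: slot * bool}|.
  by rewrite [RHS]card_prod card_bool muln2.
rewrite -sum1_card (partition_big owner xpredT) //=.
rewrite (eq_bigr (fun=> h.-1)) => [|i _]; first by rewrite sum_nat_const card_ord.
rewrite -[RHS](card_owner i) -sum1_card.
by apply: eq_bigl => s; rewrite inE.
Qed.

End CompleteSlots.

(** * Vertices at distance at most three *)

Section Near.
Variables (V : finType) (g : fgraph_on V).

Definition cnbh x := x |: g x.

(** Distance at most three: closed neighbourhoods of vertices that are not [near] are disjoint and
    have no edge between them. *)
Definition near (x y : V) :=
  [exists u, [exists w, [&& u \in cnbh x, w \in cnbh y & w \in cnbh u]]].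

Hypothesis sym : forall x y, (y \in g x) = (x \in g y).

Lemma cnbh_sym x y : (y \in cnbh x) = (x \in cnbh y).
Proof. by rewrite !inE sym eq_sym. Qed.

Lemma near_sym x y : near x y = near y x.
Proof.
have imp a b : near a b -> near b a.
  case/existsP => u /existsP[w /and3P[ua wb wu]].
  by apply/existsP; exists w; apply/existsP; exists u; rewrite wb ua cnbh_sym.
by apply/idP/idP; apply: imp.
Qed.

Lemma card_near k x : (forall x, #|g x| <= k) ->
  #|[set y in setT | near y x]| <= k.+1 ^ 3.
Proof.
move=> deg; have cN z : #|cnbh z| <= k.+1.
  by rewrite cardsU1; have := deg z; case: (_ \notin _) => /=; lia.
have bigle (X : {set V}) (F : V -> {set V}) a b : #|X| <= a ->
    (forall z, #|F z| <= b) -> #|\bigcup_(z in X) F z| <= a * b.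
  move=> Xa Fb; apply: leq_trans (card_bigcup_leq _ _) _.
  apply: leq_trans (_ : \sum_(z in X) b <= _); first exact: leq_sum.
  by rewrite sum_nat_const leq_mul2r Xa orbT.
apply: leq_trans (_ : #|\bigcup_(w in cnbh x) \bigcup_(u in cnbh w) cnbh u| <= _).
  apply: subset_leq_card; apply/subsetP => y; rewrite !inE /=.
  case/existsP => u /existsP[w /and3P[uy wx wu]].
  apply/bigcupP; exists w => //; apply/bigcupP; exists u; by rewrite // cnbh_sym.
rewrite !expnS expn0 muln1; apply: (bigle) => // w; exact: (bigle).
Qed.

End Near.

Section FarClique.
Variables (n k : nat).
Local Notation V := 'I_n.
Local Notation T := (slot k.+1).

Definition far_tuples (g : fgraph_on V) : {set k.+1.-tuple V} :=
  [set v : k.+1.-tuple V |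
     all (mem [set: V]) v && pairwise (fun x y => ~~ near g x y) v].

Lemma card_far_tuples g : g \in reg_on k setT ->
  (n - k.+1 ^ 3 * k.+1) ^ k.+1 <= #|far_tuples g|.
Proof.
move=> gT; have := @card_nonconflicting V setT (near g) (k.+1 ^ 3) k.+1.
rewrite cardsT card_ord; apply => x _; apply: card_near => [y z|y].
  exact: reg_on_sym gT.
by rewrite (reg_on_degT gT) ?inE.
Qed.

Variable v : k.+1.-tuple V.

Lemma far_tuplesP g i j u w : g \in reg_on k setT -> v \in far_tuples g ->
  i != j -> u \in cnbh g (tnth v i) -> w \in cnbh g (tnth v j) ->
  w \notin cnbh g u.
Proof.
move=> gT; rewrite inE => /andP[_ tm] ij ui wj; apply/negP => wu.
suff: near g (tnth v i) (tnth v j).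
  have sym x y : (y \in g x) = (x \in g y) by apply: reg_on_sym gT.
  have lt (a b : 'I_k.+1) : a < b -> ~~ near g (tnth v a) (tnth v b).
    move=> ab; have x0 := tnth v a.
    move/(pairwiseP x0)/(_ a b): tm; rewrite !inE size_tuple !ltn_ord !(tnth_nth x0).
    exact.
  move: ij; rewrite -val_eqE neq_ltn => /orP[/lt/negP//|/lt].
  by rewrite near_sym // => /negP.
by apply/existsP; exists u; apply/existsP; exists w; rewrite ui wj.
Qed.

Lemma far_tuple_inj g : g \in reg_on k setT -> v \in far_tuples g ->
  injective (tnth v).
Proof.
move=> gT fv i j e; apply/eqP/negPn/negP => ij.
have := far_tuplesP gT fv ij (setU11 _ _) (setU11 _ _).
by rewrite e setU11.
Qed.

Let B := [set x in v].
Let o (s : T * bool) : V := tnth v (owner s).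

(** The [k] slots owned by [i] are matched by rank with the [k] neighbours of the [i]-th entry of
    [v]. For far tuples in regular graphs the rank is in range, so the default [o s] is not
    returned. *)
Definition slot_labeling (g : fgraph_on V) : {ffun T * bool -> V} :=
  [ffun s => nth (o s) (enum (g (o s))) (index s (enum [set s' | owner s' == owner s]))].

(** These are the conditions for removing the entries of [v] by the exchange. Distance above three
    keeps the neighbours of different entries distinct and non-adjacent. *)
Lemma slot_labelingP g : g \in reg_on k setT -> v \in far_tuples g ->
  let p := slot_labeling g in
  [/\ injective p, forall s, p s \in ~: B, forall s, p s \in g (o s)
    & forall s, p (opp_slot s) \notin g (p s)].
Proof.
move=> gT fv p.
have idx s : index s (enum [set s' | owner s' == owner s]) < size (enum (g (o s))).
  have cg : #|g (o s)| = k by rewrite (reg_on_degT gT) ?inE.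
  have co := card_owner (owner s); rewrite cardE /= in co.
  by rewrite -cardE cg -[X in _ < X]co index_mem mem_enum inE.
have pg s : p s \in g (o s).
  by rewrite ffunE -[_ \in g _]mem_enum mem_nth.
have pN s : p s \in cnbh g (o s) by rewrite inE pg orbT.
split=> // [s s' e|s|s].
- have [oo|oo] := eqVneq (owner s) (owner s'); last first.
    by have := far_tuplesP gT fv oo (pN s) (pN s'); rewrite e setU11.
  have := idx s'; have := idx s; move: e; rewrite !ffunE /o oo.
  move=> e i1 i2; move/eqP: e.
  rewrite (nth_uniq _ i1 i2 (enum_uniq _)) => /eqP ei.
  have sE r : owner r = owner s' -> r \in enum [set s0 | owner s0 == owner s'].
    by move=> ro; rewrite mem_enum inE ro.
  by rewrite -(nth_index s' (sE s oo)) ei (nth_index s' (sE s' erefl)).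
- rewrite !inE; apply/negP => /tnthP[j e].
  have [oj|oj] := eqVneq (owner s) j.
    by have := pg s; rewrite /o oj e (negbTE (reg_on_irr _ gT)).
  have := far_tuplesP gT fv oj (pN s) (setU11 _ _); by rewrite e setU11.
have := far_tuplesP gT fv _ (pN s) (pN (opp_slot s)); rewrite eq_sym owner_opp_neq.
by move=> /(_ isT); rewrite inE negb_or => /andP[].
Qed.

(** Removing [v] joins its neighbours by one new edge per edge of the complete graph on [k.+1]
    vertices. The list of these new arcs recovers the labeling and thus the original graph. *)
Lemma card_far_graphs :
  #|[set g in reg_on k [set: V] | v \in far_tuples g]|
    <= SG k (n - k.+1) * (k * (n - k.+1)) ^ #|{: T}|.
Proof.
set F := [set g in _ | _].
(* If some graph has [v] as a far tuple, the entries of [v] are distinct, which gives the size of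
   [B]. *)
have [->|[g0]] := set_0Vmem F; first by rewrite cards0.
rewrite inE => /andP[g0T fv0]; have injv := far_tuple_inj g0T fv0.
have cB : #|B| = k.+1.
  rewrite cardsE; have /card_uniqP -> : uniq v.
    by rewrite -map_tnth_enum map_inj_uniq ?enum_uniq.
  by rewrite size_tuple.
have cA : #|~: B| = n - k.+1 by rewrite cardsCs setCK cB card_ord.
have AB : [disjoint ~: B & B] by rewrite -setI_eq0 setIC setICr.
have ABT : ~: B :|: B = setT by rewrite setUC setUCr.
have oB s : o s \in B by rewrite inE mem_tnth.
have oF b : b \in B -> #|[set s | o s == b]| = k.
  rewrite inE => /tnthP[i ->]; apply: etrans (card_owner i).
  by apply: eq_card => s; rewrite !inE (inj_eq injv).
apply: leq_trans (_ : \sum_(g in reg_on k (~: B))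
    #|[set q in ffun_on (mem (arcs g)) : pred {ffun T -> V * V}]| <= _); last first.
  rewrite (eq_bigr (fun=> (k * (n - k.+1)) ^ #|{: T}|)) => [|g gA].
    by rewrite sum_nat_const card_reg_on cA.
  by rewrite cardsE card_ffun_on (card_arcs gA) cA.
rewrite -card_set_pair.
apply: (leq_card_inj_in (f := fun g => (toggle o (slot_labeling g) g,
   [ffun t => (slot_labeling g (t, true), slot_labeling g (t, false))] : {ffun T -> V * V}))).
  move=> g g' _ _ [eg /ffunP ep].
  have pp : slot_labeling g = slot_labeling g'.
    by apply/ffunP => -[t b]; have := ep t; rewrite [LHS]ffunE [RHS]ffunE => -[e1 e2]; case: b.
  by move: eg; rewrite pp => /(can_inj (@toggleK _ _ _ _))->.
move=> g; rewrite inE => /andP[gT fv].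
have [injp pA pg pn] := slot_labelingP gT fv.
rewrite -ABT in gT; rewrite inE /=; apply/andP; split.
  exact: (toggle_down AB oB oF injp pA gT pg pn).
rewrite inE; apply/ffun_onP => t; rewrite ffunE inE /=.
exact: (toggle_down_edge AB oB injp pA (pn (t, true))).
Qed.

End FarClique.

(** Count the pairs of a graph and one of its far tuples, first by graph and then by tuple. *)
Lemma SG_del_clique n k :
  SG k n * (n - k.+1 ^ 3 * k.+1) ^ k.+1
    <= n ^ k.+1 * (SG k (n - k.+1) * (k * (n - k.+1)) ^ (k.+1 * k)./2).
Proof.
have cT : #|{: slot k.+1}| = (k.+1 * k)./2.
  by rewrite -[(k.+1 * k)]card_slot doubleK.
apply: leq_trans (_ : \sum_(g in reg_on k [set: 'I_n]) #|far_tuples k g| <= _).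
  rewrite SG_reg_on -sum_nat_const; apply: leq_sum => g; exact: card_far_tuples.
under eq_bigr do rewrite -sum1_card big_mkcond /=.
rewrite exchange_big /= -[X in X ^ _]card_ord -card_tuple -sum_nat_const.
apply: leq_sum => v _; rewrite -big_mkcondr /= sum1dep_card -cT.
exact: card_far_graphs.
Qed.

(** * Disconnected graphs *)

Definition DSG (k n : nat) : nat :=
  #|[set g in reg_on k [set: 'I_n] | ~~ gconnected g]|.

Lemma CSG_reg_on k n : CSG k n = #|[set g in reg_on k [set: 'I_n] | gconnected g]|.
Proof.
apply: eq_card => g; rewrite !inE /simple_graph /regular -!andbA.
by do 2!congr (_ && _); congr (_ && _); apply: eq_forallb => x; rewrite inE muln1.
Qed.

Lemma SG_split k n : SG k n = CSG k n + DSG k n.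
Proof.
rewrite SG_reg_on CSG_reg_on /DSG -(cardsID [set g | gconnected g]).
congr (_ + _); apply: eq_card => g; rewrite inE [in RHS]inE ?inE //.
by rewrite andbC.
Qed.

Lemma sum_by_card (T : finType) (P : pred nat) (f : nat -> nat) :
  \sum_(A : {set T} | P #|A|) f #|A| =
  \sum_(m < #|T|.+1 | P m) 'C(#|T|, m) * f m.
Proof.
pose c (A : {set T}) : 'I_#|T|.+1 := inord #|A|.
have cE A : c A = #|A| :> nat by rewrite inordK // ltnS max_card.
rewrite (partition_big c (fun m => P m)) => [|A]; last by rewrite cE.
apply: eq_bigr => m Pm; rewrite -card_draws -sum_nat_const.
rewrite [LHS](eq_bigl (fun A => A \in [set A : {set T} | #|A| == m])) => [|A].
  by apply: eq_bigr => A; rewrite inE => /eqP->.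
rewrite inE -val_eqE /= cE; case: eqP => [->|]; by rewrite ?Pm ?andbF.
Qed.

(** * Unions of components and clique components *)

Section Components.
Variables (V : finType) (k : nat).
Implicit Types (g : fgraph_on V) (A B : {set V}).

Definition adj g : rel V := fun u w => w \in g u.
Definition closedb g A := [forall x in A, g x \subset A].

Lemma closedbP g A : g \in reg_on k setT -> closedb g A -> closed (adj g) A.
Proof.
move=> gT /forall_inP cl x y yx; apply/idP/idP => [xA|yA].
  exact: (subsetP (cl _ xA)).
by apply: (subsetP (cl _ yA)); rewrite -(reg_on_sym _ _ gT).
Qed.

Lemma closedb_of g A : closed (adj g) A -> closedb g A.
Proof.
move=> cl; apply/forall_inP => x xA; apply/subsetP => y yx.
by rewrite -(cl x y yx).
Qed.

Lemma closedC g A : closed (adj g) A -> closed (adj g) (~: A).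
Proof. by move=> cl x y yx; rewrite !inE (cl x y yx). Qed.

Definition restrict A g : fgraph_on V := [ffun x => if x \in A then g x else set0].

Lemma restrict_reg g A : g \in reg_on k setT -> closed (adj g) A ->
  restrict A g \in reg_on k A.
Proof.
move=> gT cl; apply/reg_onP; split=> [x|x y|x]; rewrite !ffunE.
- by case: ifP => _; rewrite ?inE ?(reg_on_irr _ gT).
- have [yx|yx] := boolP (y \in g x).
    by rewrite (cl x y yx); case: ifP => _; rewrite ?inE // yx -(reg_on_sym _ _ gT) yx.
  have xy : x \notin g y by rewrite -(reg_on_sym _ _ gT).
  by case: ifP => _; case: ifP => _; rewrite ?inE ?(negbTE yx) ?(negbTE xy).
by case: ifP => _; rewrite ?cards0 ?muln0 // (reg_on_degT gT) ?inE // muln1.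
Qed.

(** With no edge leaving [A], a graph is determined by its restrictions to [A] and to the
    complement. *)
Lemma card_closed A :
  #|[set g in reg_on k setT | closedb g A]| <= SG k #|A| * SG k #|~: A|.
Proof.
rewrite -!card_reg_on -cardsX.
apply: (leq_card_inj_in (f := fun g => (restrict A g, restrict (~: A) g))).
  move=> g g' _ _ [/ffunP e1 /ffunP e2]; apply/ffunP => x.
  by have := e1 x; have := e2 x; rewrite !ffunE inE; case: (x \in A).
move=> g; rewrite inE => /andP[gT cA]; have cl := closedbP gT cA.
by rewrite in_setX /= !restrict_reg //; apply: closedC.
Qed.

(** Take the component of a vertex that does not reach everything, or its complement if that
    component is too large. *)
Lemma exists_closed g : g \in reg_on k setT ->
  ~~ [forall x, forall y, connect (adj g) x y] ->
  exists2 A : {set V}, closed (adj g) A & 0 < #|A| <= #|V|./2.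
Proof.
move=> gT; rewrite negb_forall => /existsP[x].
rewrite negb_forall => /existsP[y xy].
pose C := [set z | connect (adj g) x z].
have csym : connect_sym (adj g).
  by apply: sym_connect_sym => u w; apply: reg_on_sym gT.
have cl : closed (adj g) C.
  by apply: intro_closed => // u w uw; rewrite !inE => xu; apply: connect_trans xu (connect1 uw).
have C0 : 0 < #|C| by apply/card_gt0P; exists x; rewrite inE connect0.
have C1 : 0 < #|~: C| by apply/card_gt0P; exists y; rewrite !inE xy.
have cC := cardsC C.
have [le|lt] := leqP #|C| #|V|./2; first by exists C; rewrite ?C0.
have h : #|~: C| <= #|V|./2.
  by move: cC lt; set a := #|C|; set b := #|~: C|; set c := #|V|; lia.
by exists (~: C); [apply: closedC|rewrite C1 h].
Qed.

Definition split_clique B g :=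
  [&& g \in reg_on k setT, [forall x in B, g x == B :\ x]
    & [forall x in ~: B, forall y in ~: B, connect (adj g) x y]].

Lemma split_clique_closed B g : split_clique B g -> closed (adj g) B.
Proof.
case/and3P => gT /forall_inP gB _; apply: closedbP gT _.
by apply/forall_inP => x xB; rewrite (eqP (gB x xB)) subD1set.
Qed.

(** If [C] met the complement of [B], then [C], being closed, would contain that connected
    complement, which is too large. *)
Lemma split_clique_uniq B (C : {set V}) g : #|B| = #|C| -> #|B| < #|~: B| ->
  split_clique B g -> split_clique C g -> B = C.
Proof.
move=> BC ltB sB /split_clique_closed clC; apply/esym/eqP.
rewrite eqEcard BC leqnn andbT; apply/subsetP => x xC.
apply/negPn/negP => xB; move: ltB; rewrite ltnNge => /negP; apply.
rewrite BC; apply: subset_leq_card; apply/subsetP => y yB.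
case/and3P: sB => _ _ /forall_inP/(_ x); rewrite inE => /(_ xB).
by move=> /forall_inP/(_ y yB)/(closed_connect clC) <-.
Qed.

Lemma split_clique_disconnected B g : 0 < #|B| < #|V| -> split_clique B g ->
  ~~ [forall x, forall y, connect (adj g) x y].
Proof.
case/andP => /card_gt0P[x xB] ltB /split_clique_closed cl.
have /card_gt0P[y yB] : 0 < #|~: B| by have := cardsC B; lia.
rewrite inE in yB; apply/negP => /forallP/(_ x)/forallP/(_ y)/(closed_connect cl).
by rewrite xB (negbTE yB).
Qed.

(** Each connected graph is transported to the complement of [B] and completed by a clique on
    [B]. *)
Lemma card_split_clique B : #|B| = k.+1 ->
  CSG k #|~: B| <= #|[set g | split_clique B g]|.
Proof.
move=> cB; pose i := @enum_val V (mem (~: B)).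
have injI : injective i by apply: enum_val_inj.
have iB j : i j \in ~: B by apply: enum_valP.
have iS x : x \notin B -> exists j, x = i j.
  move=> xB; have xA : x \in ~: B by rewrite inE.
  by exists (enum_rank_in xA x); rewrite /i enum_rankK_in.
have iT : i @: setT = ~: B.
  apply/setP => x; apply/imsetP/idP => [[j _ ->]//|].
  by rewrite inE => /iS[j ->]; exists j.
pose f (g : fgraph_on 'I_#|~: B|) : fgraph_on V :=
  [ffun x => if x \in B then B :\ x else push_graph i g x].
have fi (g : fgraph_on 'I_#|~: B|) j : f g (i j) = push_graph i g (i j).
  by rewrite ffunE; have := iB j; rewrite inE => /negbTE->.
rewrite CSG_reg_on; apply: (leq_card_inj_in (f := f)).
  move=> g g' _ _ /ffunP e; apply: (can_inj (push_graphK injI)).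
  apply/ffunP => x; have [xB|/iS[j ->]] := boolP (x \in B).
    have out (h : fgraph_on 'I_#|~: B|) : push_graph i h x = set0.
      apply/setP => y; rewrite [RHS]inE; apply/negP => /push_graphP[a [b [xa _ _]]].
      by have := iB a; rewrite -xa inE xB.
    by rewrite !out.
  by have := e (i j); rewrite !fi.
move=> g /setIdP[gT /forallP gc]; rewrite inE.
have pB := push_graph_reg injI gT; rewrite iT in pB.
have fE x : f g x = if x \in B then B :\ x else push_graph i g x by rewrite ffunE.
apply/and3P; split.
- apply/reg_onP; split=> [x|x y|x].
  + by rewrite fE; case: ifP => _; rewrite ?inE ?eqxx // (reg_on_irr _ pB).
  + rewrite !fE; have [xB|xB] := boolP (x \in B); have [yB|yB] /= := boolP (y \in B).
    * by rewrite !inE xB yB eq_sym.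
    * rewrite inE (negbTE yB) andbF; apply/esym/negbTE/negP => /(reg_on_inr pB).
      by rewrite inE xB.
    * rewrite [RHS]inE (negbTE xB) andbF; apply/negbTE/negP => /(reg_on_inr pB).
      by rewrite inE yB.
    * exact: reg_on_sym pB.
  rewrite fE inE muln1; case: ifP => xB.
    by have := cardsD1 x B; rewrite cB xB => -[].
  by rewrite (reg_on_degT pB) // inE xB.
- by apply/forall_inP => x xB; rewrite fE xB.
apply/forall_inP => x; rewrite inE => /iS[a ->].
apply/forall_inP => y; rewrite inE => /iS[b ->].
have /forallP/(_ b)/connectP[p] := gc a.
elim: p a => [|c p IH] a /= => [_ ->//|/andP[ca cp] eb].
apply: connect_trans (IH c cp eb); apply: connect1.
by rewrite /adj fi in_push_graph.
Qed.

End Components.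

Lemma DSG_le k n : DSG k n <=
  \sum_(m < n.+1 | 0 < m <= n./2) 'C(n, m) * (SG k m * SG k (n - m)).
Proof.
pose P m := 0 < m <= n./2.
have := sum_by_card 'I_n P (fun m => SG k m * SG k (n - m)).
rewrite card_ord => <-.
apply: leq_trans (_ : #|\bigcup_(A : {set 'I_n} | P #|A|)
    [set g in reg_on k setT | closedb g A]| <= _).
  apply: subset_leq_card; apply/subsetP => g; rewrite inE => /andP[gT gc].
  have [A cA PA] := exists_closed gT gc; apply/bigcupP; exists A.
    by rewrite card_ord in PA.
  by rewrite inE gT; apply: closedb_of.
apply: leq_trans (card_bigcup_leq _ _) _; apply: leq_sum => A _.
have cC : #|~: A| = n - #|A| by rewrite cardsCs setCK card_ord.
by apply: leq_trans (card_closed _ _) _; rewrite cC.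
Qed.

(** The size hypothesis makes the clique component unique, so no disconnected graph is counted
    twice. *)
Lemma DSG_ge k n : k.+1 < n - k.+1 -> 'C(n, k.+1) * CSG k (n - k.+1) <= DSG k n.
Proof.
move=> ltn; have := card_draws 'I_n k.+1; rewrite card_ord => <-.
set D := [set A | _].
have cC (B : {set 'I_n}) : #|~: B| = n - #|B| by rewrite cardsCs setCK card_ord.
apply: leq_trans (_ : \sum_(B in D) #|[set g : fgraph_on 'I_n | split_clique k B g]| <= _).
  rewrite -sum_nat_const; apply: leq_sum => B; rewrite inE => /eqP cB.
  by rewrite -cB -cC; apply: card_split_clique.
rewrite -card_set_pair; apply: (leq_card_inj_in (f := snd)).
  move=> [B g] [C h]; rewrite !inE /= => /andP[/eqP cB sB] /andP[/eqP cC' sC] e.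
  rewrite e in sB *; congr pair; apply: (split_clique_uniq _ _ sB sC).
    by rewrite cB.
  by rewrite cC cB.
move=> [B g]; rewrite !inE /= => /andP[/eqP cB sB].
have /and3P[+ _ _] := sB; rewrite inE => -> /=.
by apply: (split_clique_disconnected _ sB); rewrite cB card_ord; lia.
Qed.

(** * Asymptotic estimates *)

Lemma pairing_numberSS n : pairing_number n.+2 = n.+1 * pairing_number n.
Proof. by []. Qed.

Lemma pairing_number_odd n : odd n -> pairing_number n = 0.
Proof.
have [m] := ubnP n; elim: m n => // m IH [|[|n]] // ltn odd_n.
by rewrite pairing_numberSS IH ?muln0 //; [lia | rewrite /= negbK in odd_n].
Qed.

Lemma pairing_number_even n : ~~ odd n -> 0 < pairing_number n.
Proof.
have [m] := ubnP n; elim: m n => // m IH [|[|n]] // ltn even_n.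
by rewrite pairing_numberSS muln_gt0 IH //; [lia | rewrite /= negbK in even_n].
Qed.

Lemma leq_expr e m n : m <= n -> m ^ e <= n ^ e.
Proof. by case: e => // e; rewrite leq_exp2r. Qed.

Lemma pairing_number_addl n l :
  pairing_number (n + l.*2) <= (n + l.*2) ^ l * pairing_number n.
Proof.
elim: l => [|l IH]; first by rewrite addn0 mul1n.
rewrite doubleS !addnS pairing_numberSS expnS -mulnA leq_mul //.
apply: leq_trans IH _; rewrite leq_mul2r leq_expr ?orbT //.
by rewrite -addn2 leq_addr.
Qed.

(** By induction on [L], the step reduces to [(2L+1)(L+M+1) <= (L+1)(2L+2M+1)]. *)
Lemma pairing_number_bin L M :
  pairing_number L.*2 * pairing_number M.*2 * 'C(L + M, L) <=
    pairing_number (L + M).*2.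
Proof.
elim: L => [|L IH]; first by rewrite double0 add0n bin0 muln1 mul1n.
rewrite addSn !doubleS !pairing_numberSS -(leq_pmul2l (ltn0Sn L)).
have := mul_bin_diag (L + M).+1 L; rewrite /= => e.
rewrite (mulnCA L.+1) -e (mulnCA _ (L + M).+1) -!mulnA (mulnCA (L + M).+1).
rewrite [X in X <= _](_ : _ = L.*2.+1 * (L + M).+1 *
  (pairing_number L.*2 * pairing_number M.*2 * 'C(L + M, L))); last by ring.
rewrite [X in _ <= X]mulnA; apply: (leq_mul _ IH); rewrite -!mul2n; nia.
Qed.

Lemma leq_ffact n m : (n - m) ^ m <= n ^_ m.
Proof.
suff H j : j <= m -> (n - m) ^ j <= n ^_ j by apply: H.
elim: j => [|j IH] jm; first by rewrite expn0 ffactn0.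
by rewrite ffactnSr expnSr leq_mul ?IH ?(ltnW jm) // leq_sub2l // ltnW.
Qed.

(** With [R] of linear size and [j] fixed, this says that the binomial coefficient has order at
    least [n ^ j]. *)
Lemma expn_le_bin c n R j : n <= c * (R - j) -> n ^ j <= c ^ j * j`! * 'C(R, j).
Proof.
move=> le; apply: leq_trans (leq_expr j le) _.
by rewrite expnMn -mulnA (mulnC j`!) bin_ffact leq_mul2l leq_ffact orbT.
Qed.

Lemma leq_bin_half R a b : a <= b -> b.*2 <= R -> 'C(R, a) <= 'C(R, b).
Proof.
elim: b => [|b IH]; first by rewrite leqn0 => /eqP->.
rewrite leq_eqVlt => /orP[/eqP->//|ab] bR.
apply: leq_trans (IH ab _) _; first by lia.
rewrite -(leq_pmul2l (ltn0Sn b)) mul_bin_left leq_mul2r; apply/orP; right; lia.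
Qed.

Lemma leq_bin_add n m R r : 'C(n, m) * 'C(R, r) <= 'C(n + R, m + r).
Proof.
have ltm : m < (m + r).+1 by lia.
rewrite -(binomial.Vandermonde n R) (bigD1 (Ordinal ltm)) //= addKn; exact: leq_addr.
Qed.

(** Bernoulli's inequality for [(1 + 1/n)^(d+1)], cleared of denominators. *)
Lemma bernoulli_nat n d : n ^ d * (n + d.+1) <= n.+1 ^ d.+1.
Proof.
elim: d => [|d IH]; first by rewrite expn0 expn1 mul1n addn1.
rewrite [X in _ <= X]expnS; apply: leq_trans (leq_mul (leqnn _) IH).
rewrite expnS [n * _]mulnC [n.+1 * _]mulnCA -mulnA leq_mul2l; nia.
Qed.

(* The factor n^(12 l^2) absorbs the relative error O(1/n) of the step. *)
Lemma SG_growth_step k h l n : 0 < h -> k * h = l.*2 -> 0 < k -> 8 * l <= n ->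
  SG k n * (k * n - 4 * k * l) ^ l <= SG k (n + h) * k`! ^ h ->
  SG k n * k`! ^ n * n ^ (12 * l * l) * pairing_number (k * (n + h)) <=
  SG k (n + h) * k`! ^ (n + h) * (n + h) ^ (12 * l * l) * pairing_number (k * n).
Proof.
move=> h0 kh k0 ln step; set c := 12 * l.
have [l0|l0] := posnP l; first by nia.
have c0 : 0 < c by rewrite /c; lia.
(* After Bernoulli it remains to see [n(kn + 2l) <= k(n + 12l)(n - 4l)]. The right side is
   [k(n^2 + 8ln - 48l^2)], and [n >= 8l] bounds [48l^2] by [6ln]. *)
have main : n ^ c * (k * n + l.*2) <= (n + h) ^ c * (k * n - 4 * k * l).
  have bern : n ^ c.-1 * (n + c) <= (n + h) ^ c.
    apply: leq_trans (_ : n.+1 ^ c <= _); last by apply: leq_expr; lia.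
    by have := bernoulli_nat n c.-1; rewrite prednK.
  apply: leq_trans (leq_mul bern (leqnn _)).
  rewrite -{1}(prednK c0) expnSr -!mulnA leq_mul2l; apply/orP; right.
  rewrite -mul2n. have -> : k * n - 4 * (k * l) = k * (n - 4 * l) by nia.
  have : 2 * (4 * l) <= n by lia.
  rewrite /c; move: ln; clear -k0 l0 => ln _.
  have [d ->] : exists d, n = 8 * l + d by exists (n - 8 * l); lia.
  have -> : 8 * l + d - 4 * l = 4 * l + d by lia.
  nia.
rewrite mulnDr kh.
apply: leq_trans (leq_mul (leqnn _) (pairing_number_addl _ _)) _.
have mainl := leq_expr l main; rewrite !expnMn -!expnM in mainl.
have -> : SG k n * k`! ^ n * n ^ (c * l) * ((k * n + l.*2) ^ l * pairing_number (k * n))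
  = SG k n * k`! ^ n * pairing_number (k * n) * (n ^ (c * l) * (k * n + l.*2) ^ l) by ring.
apply: leq_trans (leq_mul (leqnn _) mainl) _.
have -> : SG k n * k`! ^ n * pairing_number (k * n) * ((n + h) ^ (c * l) * (k * n - 4 * k * l) ^ l)
  = (SG k n * (k * n - 4 * k * l) ^ l) *
    (k`! ^ n * pairing_number (k * n) * (n + h) ^ (c * l)) by ring.
apply: leq_trans (leq_mul step (leqnn _)) _.
by rewrite expnD; apply: eq_leq; ring.
Qed.

(** The quotient of [SG k n * k!^n * n^(12 l^2)] by [pairing_number (k * n)] does not decrease along
    steps of [h]. Evenness keeps the denominators positive. *)
Lemma SG_growth k h l n j : 0 < h -> k * h = l.*2 -> 0 < k -> 8 * l <= n ->
  ~~ odd (k * n) ->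
  (forall n', SG k n' * (k * n' - 4 * k * l) ^ l <= SG k (n' + h) * k`! ^ h) ->
  SG k n * k`! ^ n * n ^ (12 * l * l) * pairing_number (k * (n + h * j)) <=
  SG k (n + h * j) * k`! ^ (n + h * j) * (n + h * j) ^ (12 * l * l) *
    pairing_number (k * n).
Proof.
move=> h0 kh k0 ln even step; elim: j => [|j IH]; first by rewrite muln0 addn0.
have -> : n + h * j.+1 = n + h * j + h by rewrite mulnS; lia.
have ln' : 8 * l <= n + h * j by lia.
have := SG_growth_step h0 kh k0 ln' (step _).
have F0 : 0 < pairing_number (k * (n + h * j)).
  apply: pairing_number_even; rewrite mulnDr mulnA kh oddD (negbTE even) /=.
  by rewrite oddM odd_double.
move: IH F0; set x := SG k n * _ * _; set F1 := pairing_number (k * (n + h * j)).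
set y := SG k (n + h * j) * _ * _; set F0 := pairing_number (k * n).
set F2 := pairing_number _; set z := SG _ _ * _ * _ => IH F1p IH2.
rewrite -(leq_pmul2r F1p); apply: leq_trans (_ : y * F0 * F2 <= _); last first.
  by have := leq_mul (leqnn F0) IH2; rewrite !mulnA; lia.
have := leq_mul IH (leqnn F2); lia.
Qed.

(** Growing from [n - m] to [n] at most doubles the number of vertices, so the polynomial correction
    costs only a constant power of two. *)
Lemma SG_ratio k n m : 0 < k -> 16 * k <= n -> m <= n./2 ->
  ~~ odd (k * n) -> ~~ odd (k * m) ->
  SG k (n - m) * k`! ^ (n - m) * pairing_number (k * n) <=
  2 ^ (12 * k * k) * (SG k n * k`! ^ n * pairing_number (k * (n - m))).
Proof.
move=> k0 kn mn en em.
(* For even [k] vertices are added singly; for odd [k] the parity of [k * m] makes [m] even and they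
   are added in pairs. *)
have [h [l [j [h0 kh lk mE step]]]] : exists h l j, [/\ 0 < h, k * h = l.*2, l <= k,
    m = h * j & forall n', SG k n' * (k * n' - 4 * k * l) ^ l <= SG k (n' + h) * k`! ^ h].
  case ek : (odd k); last first.
    have kE : k = k./2.*2 by rewrite -[LHS]odd_double_half ek.
    exists 1, k./2, m; split=> //; rewrite ?muln1 ?mul1n //; first by lia.
    by move=> n'; rewrite addn1 expn1; apply: SG_add1 kE.
  exists 2, k, m./2; split=> //; rewrite ?muln2 //.
    rewrite oddM ek /= in em.
    by rewrite mul2n -[LHS]odd_double_half (negbTE em).
  by move=> n'; rewrite addn2; apply: SG_add2.
have even' : ~~ odd (k * (n - m)).
  by move: en; rewrite -{1}(subnK (_ : m <= n)) ?mulnDr ?oddD ?(negbTE em) ?addbF //; lia.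
have l8 : 8 * l <= n - m by lia.
have := SG_growth j h0 kh k0 l8 even' step.
rewrite -mE subnK; last by lia.
set C := 12 * l * l => le.
have C12 : 2 ^ C <= 2 ^ (12 * k * k) by rewrite leq_pexp2l // /C leq_mul // leq_mul2l lk.
have nC : n ^ C <= 2 ^ C * (n - m) ^ C by rewrite -expnMn; apply: leq_expr; lia.
have p0 : 0 < (n - m) ^ C by rewrite expn_gt0; lia.
rewrite -(leq_pmul2r p0).
apply: leq_trans (_ : SG k n * k`! ^ n * n ^ C * pairing_number (k * (n - m)) <= _).
  by apply: leq_trans le; apply: eq_leq; ring.
apply: leq_trans (leq_mul (leq_mul (leqnn _) nC) (leqnn _)) _.
apply: leq_trans (_ : 2 ^ C * (SG k n * k`! ^ n * pairing_number (k * (n - m)) * (n - m) ^ C) <= _).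
  by apply: eq_leq; ring.
by rewrite -[X in _ <= X]mulnA leq_mul2r C12 orbT.
Qed.

(** * Bounds on the number of disconnected regular graphs *)

Lemma expnS_gt0 a b : 0 < a.+1 ^ b.
Proof. by rewrite expn_gt0. Qed.

Lemma SG_small k m : 0 < m <= k -> SG k m = 0.
Proof.
case/andP; case: m => // m _ mk; rewrite SG_reg_on; apply/eqP.
rewrite cards_eq0; apply/set0Pn => -[g gT].
have := max_card (mem (ord0 |: g ord0)); rewrite cardsU1 (reg_on_irr _ gT).
by rewrite (reg_on_degT gT) ?inE // card_ord; lia.
Qed.

Lemma SG_odd k m : odd (k * m) -> SG k m = 0.
Proof.
move=> /pairing_number_odd F0; have := SG_le_pairing_number m k.
rewrite F0 leqn0 muln_eq0 expn_eq0 => /orP[/eqP//|].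
by rewrite -leqn0 leqNgt fact_gt0.
Qed.

(** Writing the degree as [k.+2] splits the number of edges as [n + kn/2]. One Vandermonde term then
    bounds the product of the two binomials by the one that the pairing numbers absorb. *)
Lemma split_term_le k n m : 16 * k.+2 <= n -> m <= n./2 ->
    ~~ odd (k.+2 * n) -> ~~ odd (k.+2 * m) ->
  'C(n, m) * (SG k.+2 m * SG k.+2 (n - m)) * 'C((k * n)./2, (k * m)./2) <=
    2 ^ (12 * k.+2 * k.+2) * SG k.+2 n.
Proof.
move=> ln mn en em.
have ratio := SG_ratio (ltn0Sn k.+1) ln mn en em.
have upper := SG_le_pairing_number m k.+2.
have mn' : m <= n by lia.
have half j : ~~ odd (k.+2 * j) -> k.+2 * j = (j + (k * j)./2).*2.
  rewrite oddM /= negbK -oddM => /negbTE ej.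
  by have := odd_double_half (k * j); rewrite ej; lia.
set R := (k * n)./2; set r := (k * m)./2.
have nR : n + R = (m + r) + (n - m + (R - r)).
  have : r <= R by rewrite /r /R half_leq // leq_mul2l mn' orbT.
  by lia.
have knm : k.+2 * (n - m) = (n - m + (R - r)).*2.
  rewrite mulnBr (half n en) (half m em) -/R -/r nR; lia.
have := pairing_number_bin (m + r) (n - m + (R - r)).
rewrite -nR -(half n en) -(half m em) -knm => bin.
have lb := leq_bin_add n m R r.
set P := 2 ^ _; rewrite -/P in ratio.
move: ratio upper bin; set Fn := pairing_number (_ * n); set Fm := pairing_number (_ * m).
set Fd := pairing_number _; set f := k.+2`! => ratio upper bin.
have f0 : 0 < f ^ n * Fn by rewrite muln_gt0 expn_gt0 fact_gt0 pairing_number_even.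
rewrite -(leq_pmul2r f0).
have fE : f ^ n = f ^ m * f ^ (n - m) by rewrite -expnD subnKC.
apply: leq_trans (_ : ('C(n, m) * 'C(R, r)) *
    ((SG k.+2 m * f ^ m) * (SG k.+2 (n - m) * f ^ (n - m) * Fn)) <= _).
  by rewrite fE; apply: eq_leq; ring.
apply: leq_trans (leq_mul lb (leq_mul upper ratio)) _.
apply: leq_trans (_ : P * SG k.+2 n * f ^ n * (Fm * Fd * 'C(n + R, m + r)) <= _).
  by apply: eq_leq; ring.
apply: leq_trans (leq_mul (leqnn _) bin) _.
by apply: eq_leq; ring.
Qed.

(** The excess of edges over vertices in the complete graph on [k.+1] vertices. *)
Definition clique_exponent k := (k.+1 * (k - 2))./2.

Lemma DSG_upper k : 3 <= k -> exists c N, 0 < c /\ forall n, N <= n ->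
  DSG k n * n ^ clique_exponent k <= c * SG k n.
Proof.
case: k => // -[//|k] k3; rewrite /clique_exponent subn2 /=.
set E := (k.+3 * k)./2.
have evE : E.*2 = k.+3 * k.
  have ev : odd (k.+3 * k) = false by rewrite oddM /= negbK andNb.
  by rewrite -[RHS]odd_double_half ev.
set c := 2 ^ (12 * k.+2 * k.+2) * (4 ^ E.+1 * E.+1`!).
have c0 : 0 < c by rewrite /c muln_gt0 expnS_gt0 muln_gt0 expnS_gt0 fact_gt0.
exists (c * 3), (16 * k.+2 + 8 * E.+2); split; first by rewrite muln_gt0 c0.
move=> n ln.
have [on|en] := boolP (odd (k.+2 * n)).
  by have := SG_split k.+2 n; rewrite SG_odd //; lia.
have n0 : 0 < n by lia.
pose t m := 'C(n, m) * (SG k.+2 m * SG k.+2 (n - m)).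
have nR : n <= 4 * ((k * n)./2 - E.+1) by nia.
(* Only the size [k.+3] of the smallest component attains order [n^(-E)]. Every other term gains a
   further factor [1/n], which pays for the number of terms. *)
have tm m : 0 < m <= n./2 ->
    t m * n ^ E.+1 <= c * SG k.+2 n * (if m == k.+3 then n else 1).
  case/andP => m0 mn.
  have [mk|km] := leqP m k.+2; first by rewrite /t SG_small ?m0 // mul0n muln0 mul0n.
  have [om|em] := boolP (odd (k.+2 * m)); first by rewrite /t SG_odd // mul0n muln0 mul0n.
  have ln16 : 16 * k.+2 <= n by lia.
  have term := split_term_le ln16 mn en em; rewrite -/(t m) in term.
  case: (eqVneq m k.+3) => [e|mk].
    have rE : (k * m)./2 = E by rewrite e mulnC.
    rewrite rE in term; rewrite expnSr mulnA leq_mul2r; apply/orP; right.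
    have nR' : n <= 4 * ((k * n)./2 - E) by lia.
    have le := expn_le_bin nR'.
    apply: leq_trans (leq_mul (leqnn _) le) _.
    rewrite mulnCA; apply: leq_trans (leq_mul (leqnn _) term) _.
    have cle : 4 ^ E * E`! <= 4 ^ E.+1 * E.+1`!.
      by rewrite leq_mul ?leq_pexp2l // factS leq_pmull.
    rewrite mulnA leq_mul2r /c mulnC leq_mul2l cle; by rewrite !orbT.
  rewrite muln1.
  (* Here [k * m] is at least [2E + k], hence above [2E]; being even, it is at least [2E + 2]. *)
  have Er : E.+1 <= (k * m)./2.
    have : ~~ odd (k * m) by move: em; rewrite !oddM /= negbK.
    move=> /negbTE ekm; have := odd_double_half (k * m); rewrite ekm add0n.
    have : k.+4 <= m by move: mk km; rewrite neq_ltn; lia.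
    by nia.
  have rR : (k * m)./2.*2 <= (k * n)./2 by nia.
  have le := expn_le_bin nR.
  apply: leq_trans (leq_mul (leqnn _) le) _.
  apply: leq_trans (leq_mul (leqnn _) (leq_mul (leqnn _) (leq_bin_half Er rR))) _.
  by rewrite mulnCA /c [X in _ <= X]mulnAC [X in _ <= X]mulnC leq_mul2l term orbT.
rewrite -(leq_pmul2r n0) -mulnA -expnSr.
apply: leq_trans (leq_mul (DSG_le _ _) (leqnn _)) _.
rewrite big_distrl /=.
apply: leq_trans (_ : \sum_(m < n.+1 | 0 < m <= n./2)
  c * SG k.+2 n * (if m == k.+3 :> nat then n else 1) <= _).
  by apply: leq_sum => m; apply: tm.
rewrite -big_distrr /= [c * 3 * _]mulnAC -[X in _ <= X]mulnA leq_mul2l; apply/orP; right.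
(* The weights add up to at most [n + (n + 1)], which explains the factor 3. *)
apply: leq_trans (_ : \sum_(m < n.+1) (if m == k.+3 :> nat then n else 1) <= _).
  by rewrite [X in X <= _]big_mkcond leq_sum // => m _; case: ifP => //; case: ifP.
apply: leq_trans (_ : \sum_(m < n.+1) ((if m == k.+3 :> nat then n else 0) + 1) <= _).
  by apply: leq_sum => m _; case: ifP; rewrite ?leq_addr.
rewrite big_split /= sum1_card card_ord.
have k3n : k.+3 < n.+1 by lia.
rewrite (bigD1 (Ordinal k3n)) //= eqxx big1 => [|i]; first by lia.
by rewrite -val_eqE /= => /negbTE->.
Qed.

Lemma DSG_lower k : 3 <= k -> exists c N, 0 < c /\ forall n, N <= n ->
  SG k n <= c * n ^ clique_exponent k * DSG k n.
Proof.
move=> k3; have [c1 [N1 [c10 up]]] := DSG_upper k3.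
set E := clique_exponent k in up *; set Q := (k.+1 * k)./2.
have E0 : 0 < E by rewrite /E /clique_exponent; nia.
(* The surplus [k.+1] matches the order of the binomial coefficient that counts positions of the
   clique. *)
have QE : Q = E + k.+1.
  rewrite /Q /E /clique_exponent; have -> : k.+1 * k = k.+1 * (k - 2) + k.+1.*2.
    by rewrite -muln2 -mulnDr; congr (_ * _); lia.
  by rewrite halfD odd_double andbF doubleK.
set M := k.+1 ^ 3 * k.+1.
(* The factors come, in order, from [n - M >= n/2], from the arc count, from passing to connected
   graphs, and from the binomial coefficient. *)
set c := 2 ^ k.+1 * k ^ Q * (2 * (2 ^ k.+1 * k.+1`!)).
exists c, (N1 + 2 * c1 + 2 * M + 4 * k.+2); split.
  by rewrite !muln_gt0 !expn_gt0 fact_gt0 /=; lia.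
move=> n ln.
(* The upper bound, with its positive exponent, already makes at most half of the graphs
   disconnected once [n - k.+1 >= 2 * c1]. *)
have conn : SG k (n - k.+1) <= 2 * CSG k (n - k.+1).
  have /up le : N1 <= n - k.+1 by lia.
  have : DSG k (n - k.+1) * (2 * c1) <= c1 * SG k (n - k.+1).
    apply: leq_trans le; rewrite leq_mul2l; apply/orP; right.
    rewrite -(prednK E0) expnS; apply: leq_trans (leq_pmulr _ _); first by lia.
    by rewrite expn_gt0; lia.
  by rewrite SG_split; nia.
have del := SG_del_clique n k; rewrite -/M -/Q in del.
have nM : n ^ k.+1 <= 2 ^ k.+1 * (n - M) ^ k.+1 by rewrite -expnMn leq_expr //; lia.
have nb : n ^ k.+1 <= 2 ^ k.+1 * k.+1`! * 'C(n, k.+1) by apply: expn_le_bin; lia.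
have kn : (k * (n - k.+1)) ^ Q <= k ^ Q * n ^ Q.
  by rewrite -expnMn leq_expr // leq_mul2l leq_subr orbT.
have lt : k.+1 < n - k.+1 by lia.
have D := DSG_ge lt.
have p0 : 0 < n ^ k.+1 by rewrite expn_gt0; lia.
set S' := SG k (n - k.+1) in conn del; set C' := CSG k _ in conn D.
set x := n ^ k.+1 in nM nb del p0 *.
have h1 : SG k n * x <= 2 ^ k.+1 * (x * (S' * (k ^ Q * n ^ Q))).
  apply: leq_trans (leq_mul (leqnn _) nM) _; rewrite mulnCA leq_mul2l.
  apply/orP; right; apply: leq_trans del _.
  by rewrite leq_mul2l; apply/orP; right; rewrite leq_mul2l kn orbT.
have h2 : x * S' <= 2 * (2 ^ k.+1 * k.+1`!) * DSG k n.
  apply: leq_trans (leq_mul nb conn) _.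
  apply: leq_trans (leq_mul (leqnn _) D); apply: eq_leq; ring.
rewrite -(leq_pmul2r p0); apply: leq_trans h1 _.
apply: leq_trans (_ : 2 ^ k.+1 * k ^ Q * n ^ Q * (x * S') <= _).
  by apply: eq_leq; ring.
apply: leq_trans (leq_mul (leqnn _) h2) _.
have nQ : n ^ Q = n ^ E * x by rewrite QE expnD.
by rewrite nQ /c; apply: eq_leq; ring.
Qed.

(** * The relative error in an ordered field *)

Unset Implicit Arguments.
Import Order.TTheory GRing.Theory Num.Theory.
Local Open Scope ring_scope.

Theorem theorem15 (R : realFieldType) (k : nat) (hk : (3 <= k)%N) :
  exists (c1 c2 : R) (N : nat), 0 < c1 /\ 0 < c2 /\
    forall n : nat, (N <= n)%N ->
      exists e : R,
        c1 * (n%:R ^- ((k.+1 * (k - 2))./2)) <= `|e| /\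
        `|e| <= c2 * (n%:R ^- ((k.+1 * (k - 2))./2)) /\
        (CSG k n)%:R = (SG k n)%:R * (1 + e).
Proof.
have [a [Na [a0 up]]] := DSG_upper hk; have [b [Nb [b0 low]]] := DSG_lower hk.
exists (b%:R^-1), a%:R, (Na + Nb).+1; rewrite invr_gt0 !ltr0n; split=> //; split=> // n ln.
rewrite -/(clique_exponent k); set E := clique_exponent k in up low *.
have n0 : 0 < (n%:R : R) by rewrite ltr0n (leq_trans _ ln).
have nE0 : 0 < n%:R ^+ E :> R by rewrite exprn_gt0.
have aR : 1 <= a%:R :> R by rewrite ler1n.
have bR : 1 <= b%:R :> R by rewrite ler1n.
have ba : b%:R^-1 <= a%:R :> R by rewrite (le_trans _ aR) // invf_le1 // (lt_le_trans ltr01 bR).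
have {}up : (DSG k n)%:R * n%:R ^+ E <= a%:R * (SG k n)%:R :> R.
  by rewrite -natrX -!natrM ler_nat; apply: up; rewrite (leq_trans _ ln) // leqW // leq_addr.
have {}low : (SG k n)%:R <= b%:R * n%:R ^+ E * (DSG k n)%:R :> R.
  by rewrite -natrX -!natrM ler_nat; apply: low; rewrite (leq_trans _ ln) // leqW // leq_addl.
have split : (SG k n)%:R = (CSG k n)%:R + (DSG k n)%:R :> R by rewrite -natrD -SG_split.
(* Without regular graphs, as for odd [k * n], both counts vanish and any [e] satisfies the
   equation; the lower bound itself is taken, and [ba] gives the upper one. *)
have [S0|S0] := posnP (SG k n).
  exists (b%:R^-1 * n%:R ^- E).
  have pos : 0 <= b%:R^-1 * n%:R ^- E :> R by rewrite mulr_ge0 ?invr_ge0 ?ler0n // ltW.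
  rewrite ger0_norm // lexx ler_wpM2r ?invr_ge0 ?(ltW nE0) //; split=> //; split=> //.
  rewrite S0 mul0r; apply/eqP; have := SG_split k n; rewrite S0 => /esym/eqP.
  by rewrite addn_eq0 pnatr_eq0 => /andP[].
have {}S0 : 0 < (SG k n)%:R :> R by rewrite ltr0n.
(* The error is minus the proportion of disconnected graphs. *)
exists (- ((DSG k n)%:R / (SG k n)%:R)).
rewrite normrN ger0_norm ?divr_ge0 ?ler0n //; split; last split.
- rewrite ler_pdivlMr // mulrAC ler_pdivrMr // mulrC.
  rewrite ler_pdivrMr ?(lt_le_trans ltr01 bR) // (le_trans low) //.
  by rewrite -mulrA mulrC [X in X * _]mulrC.
- by rewrite ler_pdivrMr // mulrAC ler_pdivlMr.
by rewrite mulrDr mulr1 mulrN mulrCA divff ?gt_eqF // mulr1 split addrK.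
Qed.
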